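(* Let $P(\mathcal{C})=\{\boldsymbol{x}_0,\dots,\boldsymbol{x}_{p^m-1}\}$ be a digital net over $\mathbb{Z}_p$ with $p^m$ points ($p$ prime), with associated wavenumber set $\mathcal{K}(\mathcal{C})$. Let $c_0,\dots,c_{p^m-1}$ be arbitrary complex numbers and for $\boldsymbol{k}\in\mathcal{K}(\mathcal{C})$ let $\widetilde c(\boldsymbol{k})=p^{-m}\sum_{n=0}^{p^m-1}c_n\overline{\mathrm{wal}_{\boldsymbol{k}}(\boldsymbol{x}_n)}$ denote their discrete Walsh transform. Then for $n=0,\dots,p^m-1$, $$c_n=\sum_{\boldsymbol{k}\in\mathcal{K}(\mathcal{C})}\widetilde c(\boldsymbol{k})\,\mathrm{wal}_{\boldsymbol{k}}(\boldsymbol{x}_n).$$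
   Context: $p$ is prime, $\mathbb{Z}_p=\{0,\dots,p-1\}$ is the field with $p$ elements, $\mathbb{N}_0$ the non-negative integers, $\omega_p=e^{2\pi i/p}$. Digital net: $\mathcal{C}=(C_1,\dots,C_s)$ with $C_1,\dots,C_s$ $m\times m$ matrices over $\mathbb{Z}_p$. For $0\le n<p^m$ with $n=n_0+n_1p+\cdots+n_{m-1}p^{m-1}$ (base $p$ digits) let $\vec n=(n_0,\dots,n_{m-1})^T\in\mathbb{Z}_p^m$, $(y_{j,n,1},\dots,y_{j,n,m})^T=C_j\vec n\in\mathbb{Z}_p^m$, $x_{j,n}=y_{j,n,1}p^{-1}+\cdots+y_{j,n,m}p^{-m}$, and $\boldsymbol{x}_n=(x_{1,n},\dots,x_{s,n})$. $P(\mathcal{C})$ is the family $\boldsymbol{x}_0,\dots,\boldsymbol{x}_{p^m-1}$. Walsh functions: for $k=k_0+k_1p+\cdots+k_{a-1}p^{a-1}\in\mathbb{N}_0$ and $x\in[0,1)$ with base $p$ expansion $x=x_1/p+x_2/p^2+\cdots$ (infinitely many $x_i\ne p-1$), $\mathrm{wal}_k(x)=\omega_p^{x_1k_0+\cdots+x_ak_{a-1}}$; for $\boldsymbol{k}\in\mathbb{N}_0^s$, $\boldsymbol{x}\in[0,1)^s$, $\mathrm{wal}_{\boldsymbol{k}}(\boldsymbol{x})=\prod_{j=1}^s\mathrm{wal}_{k_j}(x_j)$. Dual net cosets: for $\boldsymbol{k}\in\mathbb{N}_0^s$ with $k_j=k_{j,0}+k_{j,1}p+\cdots$ let $\vec k_j^{(m)}=(k_{j,0},\dots,k_{j,m-1})^T\in\mathbb{Z}_p^m$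 and $\mathcal{C}\cdot\boldsymbol{k}=C_1^T\vec k_1^{(m)}+\cdots+C_s^T\vec k_s^{(m)}\in\mathbb{Z}_p^m$. For $\vec h\in\mathbb{Z}_p^m$ let $\mathcal{D}(\vec h)=\{\boldsymbol{k}\in\mathbb{N}_0^s:\mathcal{C}\cdot\boldsymbol{k}=\vec h\}$. Standing assumption: all $p^m$ sets $\mathcal{D}(\vec h)$ are non-empty. The set $\mathcal{K}(\mathcal{C})$: let $\nu(0)=0$, $\nu(k)=1+\max\{i:k_i\ne0\}$ for $k=k_0+k_1p+\cdots>0$, and $\nu(\boldsymbol{k})=\sum_{j=1}^s\nu(k_j)$. $\mathcal{K}(\mathcal{C})$ contains exactly one element of each $\mathcal{D}(\vec h)$, $\vec h\in\mathbb{Z}_p^m$: the element minimizing $\nu$ over $\mathcal{D}(\vec h)$, ties broken by taking the lexicographically smallest. Thus $|\mathcal{K}(\mathcal{C})|=p^m$. *)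

(* Defs.v *)
From mathcomp Require Import all_boot all_order all_algebra.
From mathcomp Require Import complex.
From mathcomp Require Import all_classical all_reals all_analysis.
Import Order.TTheory GRing.Theory Num.Theory.
Import numFieldNormedType.Exports.

Set Implicit Arguments.
Unset Strict Implicit.
Unset Printing Implicit Defensive.

Local Open Scope classical_set_scope.
Local Open Scope ring_scope.

(* Coefficient of p ^ i in the base p expansion of k. *)
Definition digit (p k i : nat) : nat := ((k %/ p ^ i) %% p)%N.

(* The first m base p digits of k, least significant first. *)
Definition digit_vec (p m k : nat) : 'cV['F_p]_m := \col_i (digit p k i)%:R.

(* For p > 1, a nonzero digit of k has index i < k, since p ^ i <= k; hence
   the maximum ranges over all nonzero digits. *)
Definition nu (p k : nat) : nat := (\max_(i < k | digit p k i != 0) i.+1)%N.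

Definition nu_tuple (p s : nat) (k : s.-tuple nat) : nat :=
  (\sum_(j < s) nu p (tnth k j))%N.

(* d i is the digit of x with weight p ^- i.+1. *)
Definition is_expansion (R : realType) (p : nat) (x : R) (d : nat -> nat) :
    Prop :=
  [/\ forall i, (d i < p)%N,
      series (fun i => (d i)%:R / p%:R ^+ i.+1 : R) @ \oo --> x
    & forall N, exists2 i, (N <= i)%N & d i <> p.-1].

(* Meaningful for 0 <= x < 1 and p > 1, when the expansion exists and is
   unique. *)
Definition real_digit (R : realType) (p : nat) (x : R) : nat -> nat :=
  xget (fun=> 0%N) [set d | is_expansion p x d].

Section Walsh.
Variables (R : realType) (p : nat).

Definition omega : R[i] :=
  (cos (2 * pi / p%:R) +i* sin (2 * pi / p%:R))%C.

Definition wal (k : nat) (x : R) : R[i] :=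
  omega ^+ (\sum_(i < nu p k) real_digit p x i * digit p k i)%N.

Definition wal_tuple (s : nat) (k : s.-tuple nat) (x : 'rV[R]_s) : R[i] :=
  \prod_(j < s) wal (tnth k j) (x 0 j).

End Walsh.

Section DigitalNet.
Variables (p m s : nat) (C : 'I_s -> 'M['F_p]_m).

Definition net_point (R : realType) (n : nat) : 'rV[R]_s :=
  \row_j \sum_(i < m)
    ((C j *m digit_vec p m n) i 0 : nat)%:R / p%:R ^+ i.+1.

Definition net_dot (k : s.-tuple nat) : 'cV['F_p]_m :=
  \sum_(j < s) (C j)^T *m digit_vec p m (tnth k j).

Definition dual_coset (h : 'cV['F_p]_m) : set (s.-tuple nat) :=
  [set k | net_dot k = h].

Definition is_minimal_in (D : set (s.-tuple nat)) (k : s.-tuple nat) : Prop :=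
  D k /\
  forall k', D k' ->
    (nu_tuple p k < nu_tuple p k')%N \/
    nu_tuple p k = nu_tuple p k' /\
      ((k : s.-tuplelexi nat) <= (k' : s.-tuplelexi nat))%O.

Definition wavenumbers : set (s.-tuple nat) :=
  [set k | exists h, is_minimal_in (dual_coset h) k].

Definition walsh_transform (R : realType) (c : 'I_(p ^ m) -> R[i])
    (k : s.-tuple nat) : R[i] :=
  (p%:R ^+ m)^-1 *
    \sum_(n < p ^ m) c n * (wal_tuple p k (net_point R n))^*.

End DigitalNet.

(* Main.v *)
Require Import Defs.
From mathcomp Require Import all_boot all_order all_algebra.
From mathcomp Require Import complex.
From mathcomp Require Import all_classical all_reals all_analysis.
Import Order.TTheory GRing.Theory Num.Theory.
Import numFieldNormedType.Exports.

Set Implicit Arguments.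
Unset Strict Implicit.
Unset Printing Implicit Defensive.

Local Open Scope classical_set_scope.
Local Open Scope ring_scope.

(** The Walsh values on a digital net are additive characters: since the
    digits of the j-th coordinate of the n-th point are the entries of
    [C j *m digit_vec p m n], [wal_tuple_net_point] gives
      [wal_tuple p k (net_point C R n) = chi (net_dot C k . digit_vec p m n)]
    with [chi a = omega ^+ a] a nontrivial character of the prime field.  So
    the value depends on [k] only through the coset label [h = net_dot C k].

    As the wavenumbers represent each label exactly once
    ([sum_wavenumbers]), the sum over wavenumbers becomes a sum over all
    vectors [h], and the claim is Fourier inversion on the group of vectors
    over the prime field.  Exchanging the two sums leaves, for each index [j],
    the character sum of [chi (h . (digit_vec p m n - digit_vec p m j))] over
    [h].  By [sum_Fp_char] it vanishes unless the two digit vectors agree,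
    that is unless [j = n] ([digit_vec_inj]), and is [p ^ m] in that case.

    Two points need an argument because of the way the objects are defined.
    Digits of a real number are selected among its base p expansions that do
    not end in repeated digits p - 1, so computing them requires uniqueness of
    such an expansion ([expansion_unique]).
    And a wavenumber is selected by minimality, so each nonempty coset must be
    shown to have a least element ([ex_minimal]), which is unique
    ([minimal_unique]). *)

(** * Base p digits of natural numbers *)

Lemma digit_eq0 p k i : (1 < p)%N -> (nu p k <= i)%N -> digit p k i = 0%N.
Proof.
move=> p_gt1 le_nu_i; apply/eqP; apply: contraLR le_nu_i => dig_neq0.
rewrite -ltnNge.
have lt_ik : (i < k)%N.
  apply: leq_trans (ltn_expl i p_gt1) _; rewrite leqNgt.
  by apply: contraNN dig_neq0 => lt_k; rewrite /digit divn_small ?mod0n.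
exact: (@leq_bigmax_cond _ (fun j : 'I_k => digit p k j != 0%N)
          (fun j => j.+1) (Ordinal lt_ik) dig_neq0).
Qed.

(** This is what makes the tuples of given weight finite in number. *)
Lemma ltn_exp_nu p k : (1 < p)%N -> (k < p ^ nu p k)%N.
Proof.
move=> p_gt1; case: (posnP k) => [->|k_gt0]; first by rewrite expn_gt0 ltnW.
have /andP[lek ltk] := trunc_log_bounds p_gt1 k_gt0.
(* The leading digit of k sits at position t and is nonzero, so t < nu p k. *)
set t := trunc_log p k in lek ltk.
apply: (leq_trans ltk); rewrite leq_exp2l //.
rewrite ltnNge; apply/negP => le_nu_t; have := digit_eq0 p_gt1 le_nu_t.
rewrite /digit.
have pt_gt0 : (0 < p ^ t)%N by rewrite expn_gt0 ltnW.
rewrite modn_small; last by rewrite ltn_divLR // -expnS.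
by apply/eqP; rewrite -lt0n divn_gt0.
Qed.

Lemma sum_digit p k N :
  (\sum_(i < N) digit p k i * p ^ i)%N = (k %% p ^ N)%N.
Proof.
elim: N => [|N IHN]; first by rewrite big_ord0 expn0 modn1.
rewrite big_ord_recr IHN /= /digit modn_divl -expnS addnC.
rewrite [RHS](divn_eq _ (p ^ N)%N) modn_dvdm //.
by rewrite expnS dvdn_mull.
Qed.

(** * Uniqueness of base p expansions of real numbers *)

Section Expansion.
Context {R : realType} {p : nat}.
Hypothesis p_gt1 : (1 < p)%N.

Let p_gt0 : 0 < p%:R :> R. Proof. by rewrite ltr0n ltnW. Qed.

Lemma digit_term_le (d : nat -> nat) n : (d n < p)%N ->
  (d n)%:R / p%:R ^+ n.+1 + (p%:R ^+ n.+1)^-1 <= (p%:R ^+ n)^-1 :> R.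
Proof.
move=> dn; rewrite -{2}[(p%:R ^+ n.+1)^-1]mul1r -mulrDl natr1.
by rewrite ler_pdivrMr ?exprn_gt0 // exprS mulrCA mulVf ?expf_neq0 ?gt_eqF //
  mulr1 ler_nat.
Qed.

(** The partial sums increase to x, while the partial sums plus the weight
    of one unit in the last place decrease.  The upper bound is strict
    because the latter sequence drops strictly at every digit other than
    p - 1, and such digits occur beyond any rank. *)
Lemma expansion_bounds (x : R) d N : is_expansion p x d ->
  \sum_(i < N) (d i)%:R / p%:R ^+ i.+1 <= x
    < \sum_(i < N) (d i)%:R / p%:R ^+ i.+1 + (p%:R ^+ N)^-1.
Proof.
move=> [d_lt cvx d_inf].
pose S n : R := \sum_(i < n) (d i)%:R / p%:R ^+ i.+1.
have cvS : S @ \oo --> x.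
  rewrite (_ : S = series (fun i => (d i)%:R / p%:R ^+ i.+1 : R)) //.
  by apply/funext => n; rewrite /series /= big_mkord.
have S_S n : S n.+1 = S n + (d n)%:R / p%:R ^+ n.+1 by rewrite /S big_ord_recr.
have S_homo : {homo S : n k / (n <= k)%N >-> n <= k}.
  apply: homo_leq => [//|? ? ?|n]; first exact: le_trans.
  by rewrite S_S lerDl divr_ge0 // exprn_ge0 // ltW.
have V_homo :
    {homo (fun n => S n + (p%:R ^+ n)^-1) : n k / (n <= k)%N >-> k <= n}.
  apply: homo_leq => [//|? ? ? h1 h2|n]; first exact: le_trans h2 h1.
  by rewrite S_S -addrA lerD2l digit_term_le.
have le_x n : x <= S n + (p%:R ^+ n)^-1.
  apply: (cvgr_to_le cvS); exists n => // k /= le_nk.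
  apply: le_trans (V_homo _ _ le_nk).
  by rewrite lerDl invr_ge0 exprn_ge0 // ltW.
apply/andP; split.
  apply: (cvgr_to_ge cvS); exists N => // k /= le_Nk; exact: S_homo.
have [i le_Ni /eqP di_neq] := d_inf N.
apply: lt_le_trans (V_homo _ _ le_Ni); apply: le_lt_trans (le_x i.+1) _.
rewrite S_S -addrA ltrD2l -{2}[(p%:R ^+ i.+1)^-1]mul1r -mulrDl natr1.
rewrite ltr_pdivrMr ?exprn_gt0 // exprS mulrCA mulVf ?expf_neq0 ?gt_eqF //.
rewrite mulr1 ltr_nat ltn_neqAle d_lt andbT.
by apply: contra_neq di_neq => <-.
Qed.

(** If two expansions agree below rank n, both digits of rank n locate x in
    half-open intervals of the same length p ^- n.+1 on a common grid;
    these intervals meet, hence coincide. *)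
Lemma expansion_unique (x : R) d e :
  is_expansion p x d -> is_expansion p x e -> d = e.
Proof.
move=> xd xe; apply/funext; elim/ltn_ind => n IHn.
have pn_gt0 : 0 < p%:R ^+ n.+1 :> R by rewrite exprn_gt0.
have le_digit f g : is_expansion p x f -> is_expansion p x g ->
    (forall i, (i < n)%N -> f i = g i) -> (f n <= g n)%N.
  move=> xf xg eq_fg.
  have /andP[lf _] := expansion_bounds n.+1 xf.
  have /andP[_ ug] := expansion_bounds n.+1 xg.
  have := le_lt_trans lf ug; rewrite !big_ord_recr /=.
  rewrite (eq_bigr (fun i : 'I_n => (g i)%:R / p%:R ^+ i.+1)); last first.
    by move=> i _; rewrite eq_fg.
  rewrite -addrA ltrD2l -{3}[(p%:R ^+ n.+1)^-1]mul1r -mulrDl natr1.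
  by rewrite ltr_pM2r ?invr_gt0 // ltr_nat ltnS.
apply/eqP; rewrite eqn_leq !le_digit // => i /IHn //.
Qed.

Lemma real_digitE (x : R) d : is_expansion p x d -> real_digit p x = d.
Proof.
by move=> xd; apply: xget_unique => // e xe; apply: expansion_unique xe xd.
Qed.

End Expansion.

(** * Digits of the points and of the indices of a net *)

Section NetDigits.
Variables (R : realType) (p m : nat).
Hypothesis p_prime : prime p.

Let p_gt1 : (1 < p)%N := prime_gt1 p_prime.

Lemma Fp_val_lt (a : 'F_p) : (a < p)%N.
Proof. by rewrite -[X in (_ < X)%N](Fp_cast p_prime). Qed.

Definition zero_padded (y : 'cV['F_p]_m) (i : nat) : nat :=
  if insub i is Some j then (y (j : 'I_m) 0 : nat) else 0%N.

Lemma zero_padded_ord (y : 'cV['F_p]_m) (i : 'I_m) : zero_padded y i = y i 0.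
Proof. by rewrite /zero_padded valK. Qed.

Lemma zero_padded_ge y i : (m <= i)%N -> zero_padded y i = 0%N.
Proof. by move=> le_mi; rewrite /zero_padded insubF // ltnNge le_mi. Qed.

(** The padding zeros differ from p - 1 because p > 1, so this is the
    normalised expansion. *)
Lemma is_expansion_zero_padded (y : 'cV['F_p]_m) :
  is_expansion p (\sum_(i < m) (y i 0 : nat)%:R / p%:R ^+ i.+1 : R)
    (zero_padded y).
Proof.
split=> [i||N].
- rewrite /zero_padded; case: insub => [j|]; first exact: Fp_val_lt.
  exact: prime_gt0.
- apply: cvg_near_cst; exists m => // n /= le_mn.
  rewrite /series /= big_mkord -(subnKC le_mn) big_split_ord /=.
  rewrite [X in _ + X]big1.
    by rewrite addr0; apply: eq_bigr => i _; rewrite zero_padded_ord.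
  by move=> i _; rewrite zero_padded_ge ?leq_addr // mul0r.
- exists (maxn N m); first exact: leq_maxl.
  rewrite zero_padded_ge ?leq_maxr //; case: p p_gt1 => [|[|]] //.
Qed.

Lemma digit_vec_inj n n' : (n < p ^ m)%N -> (n' < p ^ m)%N ->
  digit_vec p m n = digit_vec p m n' -> n = n'.
Proof.
move=> lt_n lt_n' /matrixP eq_nn'.
rewrite -(modn_small lt_n) -(modn_small lt_n') -!sum_digit.
apply: eq_bigr => i _; congr (_ * _)%N.
have := congr1 val (eq_nn' i 0); rewrite !mxE /= !val_Fp_nat //.
by rewrite /digit !modn_mod.
Qed.

End NetDigits.

(** * An additive character of the prime field *)

Section Character.
Variables (R : realType) (p : nat).
Hypothesis p_prime : prime p.

Lemma omegaX n : omega R p ^+ n =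
  (cos (n%:R * (2 * pi / p%:R)) +i* sin (n%:R * (2 * pi / p%:R)))%C.
Proof.
rewrite /omega; move: (2 * pi / p%:R) => t.
elim: n => [|n IHn]; first by rewrite mul0r cos0 sin0.
rewrite exprSr IHn -natr1 mulrDl mul1r cosD sinD; simpc.
by rewrite [X in (_ +i* X)%C]addrC.
Qed.

Lemma omega_unity : omega R p ^+ p = 1.
Proof.
rewrite omegaX mulrC divfK ?pnatr_eq0 -?lt0n ?prime_gt0 //.
by rewrite mulr_natl cos2pi sin2pi.
Qed.

(** The angle 2 pi / p lies in ]0, pi], where cos is injective and so takes
    the value 1 nowhere. *)
Lemma omega_neq1 : omega R p != 1.
Proof.
have p_gt0 : 0 < p%:R :> R by rewrite ltr0n prime_gt0.
have pi_gt0 := pi_gt0 R.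
apply/eqP => /(congr1 (@complex.Re R)) /= cos_eq.
have t_gt0 : 0 < 2 * pi / p%:R :> R by rewrite divr_gt0 ?mulr_gt0.
suff : 2 * pi / p%:R = 0 :> R by move/eqP; rewrite gt_eqF.
apply: (cos_inj _ _ (etrans cos_eq (esym (@cos0 R))));
  rewrite in_itv /= ?lexx ?(ltW t_gt0) ?(ltW pi_gt0) //=.
by rewrite ler_pdivrMr // mulrC ler_pM2l // ler_nat prime_gt1.
Qed.

Definition Fp_char (a : 'F_p) : R[i] := omega R p ^+ a.

Lemma Fp_char_nat n : Fp_char n%:R = omega R p ^+ n.
Proof. by rewrite /Fp_char val_Fp_nat // expr_mod // omega_unity. Qed.

Lemma Fp_char0 : Fp_char 0 = 1.
Proof. by []. Qed.

Lemma Fp_char1 : Fp_char 1 = omega R p.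
Proof. by rewrite -[1]/(1%:R) Fp_char_nat. Qed.

Lemma Fp_charD : {morph Fp_char : a b / a + b >-> a * b}.
Proof.
by move=> a b; rewrite -[a]natr_Zp -[b]natr_Zp -natrD !Fp_char_nat exprD.
Qed.

Lemma Fp_char_sum (I : finType) (F : I -> 'F_p) :
  Fp_char (\sum_i F i) = \prod_i Fp_char (F i).
Proof. exact: (big_morph _ Fp_charD Fp_char0). Qed.

(** Both sides are inverse to [Fp_char a], as omega has modulus 1. *)
Lemma Fp_charN a : Fp_char (- a) = (Fp_char a)^*.
Proof.
have omega_conj : omega R p * (omega R p)^* = 1.
  by rewrite /omega; simpc; rewrite -!expr2 cos2Dsin2 mulrC addNr.
have conj_char : Fp_char a * (Fp_char a)^* = 1.
  by rewrite /Fp_char rmorphXn /= -exprMn omega_conj expr1n.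
have char_neq0 : Fp_char a != 0.
  by apply: contra_eq_neq conj_char => ->; rewrite mul0r eq_sym oner_neq0.
by apply: (mulfI char_neq0); rewrite conj_char -Fp_charD subrr.
Qed.

(** Orthogonality.  For v != 0, choose h0 with h0 . v = 1; translating the
    summation variable by h0 multiplies the sum by omega != 1, so the sum is
    zero. *)
Lemma sum_Fp_char m (v : 'cV['F_p]_m) :
  \sum_(h : 'cV['F_p]_m) Fp_char ((h^T *m v) 0 0) =
    if v == 0 then p%:R ^+ m else 0.
Proof.
case: eqVneq => [->|v_neq0].
  under eq_bigr do rewrite mulmx0 mxE Fp_char0.
  by rewrite sumr_const card_mx muln1 card_Fp // natrX.
have [i vi_neq0] : exists i, v i 0 != 0.
  apply/existsP; apply: contraR v_neq0; rewrite negb_exists => /forallP v0.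
  apply/eqP/colP => i; rewrite mxE; exact/eqP/negPn/v0.
pose h0 : 'cV['F_p]_m := (v i 0)^-1 *: delta_mx i 0.
have h0v : (h0^T *m v) 0 0 = 1.
  by rewrite /h0 linearZ /= trmx_delta -scalemxAl -rowE !mxE mulVf.
set S := LHS.
have : S = omega R p * S.
  rewrite {1}/S (reindex_inj (addrI h0)) mulr_sumr; apply: eq_bigr => h _.
  by rewrite linearD mulmxDl mxE Fp_charD h0v Fp_char1.
move/eqP; rewrite -{1}[S]mul1r -subr_eq0 -mulrBl mulf_eq0 subr_eq0 eq_sym.
by rewrite (negPf omega_neq1) => /eqP.
Qed.

End Character.

(** * Walsh functions on the points of a net *)

Section Net.
Variables (R : realType) (p m s : nat) (C : 'I_s -> 'M['F_p]_m).
Hypothesis p_prime : prime p.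

Lemma wal_digits k (y : 'cV['F_p]_m) :
  wal p k (\sum_(i < m) (y i 0 : nat)%:R / p%:R ^+ i.+1 : R) =
    Fp_char R (((digit_vec p m k)^T *m y) 0 0).
Proof.
have p_gt1 := prime_gt1 p_prime.
pose f i := (zero_padded y i * digit p k i)%N.
rewrite /wal (real_digitE p_gt1 (is_expansion_zero_padded R p_prime y)).
(* The two ranges differ only where a digit of k or of y is zero, whichever
   of nu p k and m is larger. *)
have -> : (\sum_(i < nu p k) f i = \sum_(i < m) f i)%N.
  rewrite -(big_mkord xpredT f) -(big_mkord xpredT f).
  have trunc a b : (a <= b)%N -> (forall i, (a <= i)%N -> f i = 0%N) ->
      (\sum_(0 <= i < a) f i = \sum_(0 <= i < b) f i)%N.
    move=> le_ab f0; rewrite [RHS](big_cat_nat (leq0n a) le_ab) /=.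
    rewrite [X in (_ + X)%N]big_nat [X in (_ + X)%N]big1 ?addn0 //.
    by move=> i /andP[/f0].
  case/orP: (leq_total (nu p k) m) => [/trunc|/trunc] ->// i le_i.
    by rewrite /f digit_eq0 ?muln0.
  by rewrite /f zero_padded_ge.
rewrite -Fp_char_nat // natr_sum mxE; congr (Fp_char R _).
apply: eq_bigr => i _.
by rewrite !mxE /f zero_padded_ord natrM natr_Zp mulrC.
Qed.

(** The exponents add up over the coordinates, and the transpose moves each
    [C j] from the digits of n to those of [tnth k j], where these products
    sum to [net_dot C k]. *)
Lemma wal_tuple_net_point (k : s.-tuple nat) n :
  wal_tuple p k (net_point C R n) =
    Fp_char R (((net_dot C k)^T *m digit_vec p m n) 0 0).
Proof.
rewrite /net_dot linear_sum mulmx_suml summxE Fp_char_sum //.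
apply: eq_bigr => j _.
by rewrite /= trmx_mul trmxK -mulmxA -wal_digits mxE.
Qed.

End Net.

(** * Wavenumbers as coset representatives *)

Section Wavenumbers.
Variables (p m s : nat) (C : 'I_s -> 'M['F_p]_m).
Hypothesis p_gt1 : (1 < p)%N.

(** Only finitely many tuples have the least weight N attained on D: their
    entries are below p ^ N by [ltn_exp_nu].  So the lexicographic minimum can
    be taken over the finite type of tuples with entries in 'I_(p ^ N). *)
Lemma ex_minimal (D : set (s.-tuple nat)) : D !=set0 ->
  exists k, is_minimal_in p D k.
Proof.
move=> [k0 Dk0].
pose P N := `[< exists2 k, D k & nu_tuple p k = N >].
have exP : exists N, P N by exists (nu_tuple p k0); apply/asboolP; exists k0.
case: (ex_minnP exP) => N /asboolP[k1 Dk1 nu_k1] min_N.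
pose T := s.-tuple 'I_(p ^ N).
pose val_T (t : T) : s.-tuplelexi nat := [tuple of map val t].
have lift_T k : nu_tuple p k = N -> exists t : T, val_T t = k.
  move=> nu_k.
  have lt_k j : (tnth k j < p ^ N)%N.
    apply: leq_trans (ltn_exp_nu _ p_gt1) _; rewrite leq_exp2l // -nu_k.
    by rewrite /nu_tuple (bigD1 j) //= leq_addr.
  exists [tuple Ordinal (lt_k j) | j < s].
  by apply: eq_from_tnth => j; rewrite tnth_map tnth_mktuple.
pose Q (t : T) := `[< D (val_T t) /\ nu_tuple p (val_T t) = N >].
have [t1 t1E] := lift_T _ nu_k1.
have Qt1 : Q t1 by apply/asboolP; rewrite t1E.
case: (@arg_minP _ (s.-tuplelexi nat) _ t1 Q val_T Qt1)
  => t /asboolP[Dt nu_t] min_t.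
exists (val_T t); split=> // k' Dk'; rewrite nu_t.
have: (N <= nu_tuple p k')%N by apply: min_N; apply/asboolP; exists k'.
rewrite leq_eqVlt => /orP[/eqP nu_k'|]; [right; split=> // | by left].
have [t' t'E] := lift_T _ (esym nu_k'); rewrite -t'E; apply: min_t.
by apply/asboolP; rewrite t'E.
Qed.

Lemma minimal_unique (D : set (s.-tuple nat)) k k' :
  is_minimal_in p D k -> is_minimal_in p D k' -> k = k'.
Proof.
move=> [Dk min_k] [Dk' min_k'].
case: (min_k _ Dk') => [lt_kk'|[eq_kk' le_kk']]; case: (min_k' _ Dk).
- by move=> lt_k'k; have := ltn_trans lt_kk' lt_k'k; rewrite ltnn.
- by case=> eq_k'k; rewrite eq_k'k ltnn in lt_kk'.
- by rewrite eq_kk' ltnn.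
- by case=> _ le_k'k; apply/(@le_anti _ (s.-tuplelexi nat));
    rewrite le_kk' le_k'k.
Qed.

(** The map [net_dot C] is a bijection from the wavenumbers to the labels; its
    inverse picks the minimal element of each coset. *)
Lemma sum_wavenumbers (V : nmodType) (F : s.-tuple nat -> V)
    (f : 'cV['F_p]_m -> V) :
  (forall h, dual_coset C h !=set0) ->
  (forall k, F k = f (net_dot C k)) ->
  \sum_(k \in wavenumbers C) F k = \sum_h f h.
Proof.
move=> nonempty Ff.
have [g min_g] := choice (fun h => ex_minimal (nonempty h)).
have dot_g h : net_dot C (g h) = h by have [] := min_g h.
have g_bij : set_bij setT (wavenumbers C) g.
  split=> [h _|h h' _ _ eq_g|k [h min_k]]; first by exists h.
    by rewrite -(dot_g h) -(dot_g h') eq_g.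
  by exists h => //; apply: minimal_unique (min_g h) min_k.
rewrite (reindex_fsbig _ _ _ _ g_bij).
have -> : [set: 'cV['F_p]_m] = [set` index_enum 'cV['F_p]_m].
  by apply/seteqP; split=> // h _ /=; apply: mem_index_enum.
rewrite -(fsbig_seq _ _ (index_enum_uniq _)).
by apply: eq_bigr => h _; rewrite Ff dot_g.
Qed.

End Wavenumbers.

(** * Inversion of the discrete Walsh transform *)

Theorem lemma3p1 (R : realType) (p m s : nat) (C : 'I_s -> 'M['F_p]_m)
    (p_prime : prime p)
    (cosets_nonempty : forall h : 'cV['F_p]_m, dual_coset C h !=set0)
    (c : 'I_(p ^ m) -> R[i]) (n : 'I_(p ^ m)) :
  c n = \sum_(k \in wavenumbers C)
          walsh_transform C c k * wal_tuple p k (net_point C R n).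
Proof.
pose v j := digit_vec p m j.
pose chi (h : 'cV['F_p]_m) j := Fp_char R ((h^T *m v j) 0 0).
rewrite (@sum_wavenumbers _ _ _ _ (prime_gt1 p_prime) _ _
    (fun h => (p%:R ^+ m)^-1 * (\sum_(j < p ^ m) c j * (chi h j)^*) *
              chi h n)) //; last first.
  move=> k; rewrite /walsh_transform wal_tuple_net_point //.
  by under eq_bigr do rewrite wal_tuple_net_point //.
have pm_neq0 : p%:R ^+ m != 0 :> R[i].
  by rewrite expf_neq0 // pnatr_eq0 -lt0n prime_gt0.
apply: (mulfI pm_neq0).
under eq_bigr do rewrite -mulrA; rewrite -mulr_sumr mulVKf //.
under eq_bigr do rewrite mulr_suml; rewrite exchange_big /=.
have orth j : \sum_h c j * (chi h j)^* * chi h n =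
    if j == n then p%:R ^+ m * c n else 0.
  transitivity (c j *
    \sum_(h : 'cV['F_p]_m) Fp_char R ((h^T *m (v n - v j)) 0 0)).
    rewrite mulr_sumr; apply: eq_bigr => h _.
    rewrite -mulrA -Fp_charN // -Fp_charD //; congr (_ * Fp_char R _).
    by rewrite mulmxBr !mxE addrC.
  rewrite sum_Fp_char // subr_eq0; case: (eqVneq j n) => [->|neq_jn].
    by rewrite eqxx mulrC.
  rewrite ifN ?mulr0 //; apply: contra neq_jn => /eqP eq_v.
  by apply/eqP/val_inj/esym/(digit_vec_inj p_prime (ltn_ord _) (ltn_ord _)).
rewrite (bigD1 n) //= orth eqxx big1 ?addr0 // => j neq_jn.
by rewrite orth (negPf neq_jn).
Qed.
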